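(* Let $\kappa$ be a finite field of characteristic $p\neq 2$, fix $c,d\in\kappa^\times$, and define $$\Pi_1(u,T) = c(T^2+u^p)^2 + du, \qquad \Pi_2(u,T) = 1 + 4\Pi_1(u,T) \quad \in \kappa[u][T].$$ Then there exist infinitely many closed points $u_0 \in \mathbf{A}^1_\kappa$ such that $\Pi_1(u_0,T)$ and $\Pi_2(u_0,T)$ are both irreducible in $\kappa_0[T]$, where $\kappa_0 = \kappa(u_0)$ is the residue field of $u_0$ and $\Pi_j(u_0,T)$ denotes the image of $\Pi_j$ under $\kappa[u]\to\kappa_0$. *)

(* Defs.v *)
From HB Require Import structures.
From mathcomp Require Import all_boot all_order all_algebra all_fingroup all_field.
Set Implicit Arguments. Unset Strict Implicit. Unset Printing Implicit Defensive.
Import GRing.Theory.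
Local Open Scope ring_scope.

(* Polynomials in kappa[u][T], represented as {poly {poly kappa}}:
   outer variable 'X is T, inner variable 'X is u. *)
Definition Pi1 (F : fieldType) (p : nat) (c d : F) : {poly {poly F}} :=
  (c%:P)%:P * ('X ^+ 2 + ('X ^+ p)%:P) ^+ 2 + (d *: 'X)%:P.

Definition Pi2 (F : fieldType) (p : nat) (c d : F) : {poly {poly F}} :=
  1 + 4%:R * Pi1 p c d.

(* The image of P in kappa_0[T], where kappa_0 = kappa[u]/(f) is the residue
   field of the closed point given by the monic irreducible f. *)
Definition at_point (F : finFieldType) (f : {poly F})
  (mi : monic_irreducible_poly f) (P : {poly {poly F}})
  : {poly {poly %/ f with mi}} :=
  map_poly (fun q : {poly F} => (in_qpoly f q : {poly %/ f with mi})) P.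

(* Main.v *)
(* With a = u^p, the polynomial e (T^2 + a)^2 + g is irreducible over the residue
   field as soon as -g/e and a^2 + g/e are nonsquares there, so four polynomials
   in u must be nonsquares at u_0. Over a finite extension K of kappa where these
   four split (and c d becomes a square), reciprocity - computing det g(C) for the
   companion matrix C of the minimal polynomial P of u_0 - expresses each condition
   through the quadratic characters of the values P(b), b in K. It remains to find
   irreducible P over K of large degree with prescribed quadratic characters of all
   P(b). This is a Dirichlet theorem modulo X^q - X for quadratic characters; since
   the L-functions are polynomials, it is proved by finite sums in the manner of
   Mertens. Finally u_0 is viewed as a closed point over kappa. *)
Require Import Defs.
From HB Require Import structures.
From mathcomp Require Import all_boot all_order all_algebra all_fingroup all_field.
From mathcomp Require Import ring lra zify.
Set Implicit Arguments. Unset Strict Implicit. Unset Printing Implicit Defensive.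
Import Order.TTheory GRing.Theory Num.Theory.
Local Open Scope ring_scope.

(** * Nonvanishing at 1 and bounded partial sums *)

(** Passing to partial sums multiplies the generating series by [1/(1 - T)]. Under [T d/dT log] this
    factor becomes [T/(1 - T)], which adds 1 to every weight. *)
Lemma log_derivative_partial_sums (R : comNzRingType) (a s : nat -> R) :
  a 0%N = 1 ->
  (forall n, n%:R * a n = \sum_(i < n) s i.+1 * a (n - i.+1)%N) ->
  forall n, n%:R * \sum_(j < n.+1) a j =
    \sum_(i < n) (1 + s i.+1) * \sum_(j < (n - i.+1).+1) a j.
Proof.
move=> a0 rec; elim=> [|n IHn]; first by rewrite mul0r big_ord0.
rewrite big_ord_recr /= mulrDr rec -natr1 mulrDl mul1r IHn.
have rev_sum : \sum_(j < n.+1) a j = \sum_(i < n.+1) a (n.+1 - i.+1)%N.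
  by rewrite (reindex_inj rev_ord_inj); apply: eq_bigr => i _.
rewrite rev_sum -addrA -big_split /= big_ord_recr /= subSS subnn.
rewrite [in RHS]big_ord_recr /= subnn big_ord1 addrA -big_split /=.
congr (_ + _); last by ring.
apply: eq_bigr => i _; rewrite subSS -(subnSK (ltn_ord i)).
by rewrite [in RHS]big_ord_recr /=; ring.
Qed.

(* Here [a n] and [s k] are the coefficients of L(T) and T L'(T)/L(T) after the
   substitution T -> T/q. The partial sums [r n] of [a] are the coefficients of
   zeta * L; they satisfy the recurrence with weights 1 + s k >= 0, hence are
   nonnegative, positive for even n, and eventually equal to L(1), which is
   therefore positive. *)
Lemma nonvanishing_bounds_partial_sums (R : realFieldType) (a s : nat -> R) (D : nat) :
  a 0%N = 1 ->
  (forall n, n%:R * a n = \sum_(i < n) s i.+1 * a (n - i.+1)%N) ->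
  (forall k, (0 < k)%N -> `|s k| <= 1) ->
  (forall k, (0 < k)%N -> ~~ odd k -> -1 < s k) ->
  (forall n, (D <= n)%N -> a n = 0) ->
  exists C, forall M, `|\sum_(i < M) s i.+1| <= C.
Proof.
move=> a0 rec s_le1 s_gtN1 a_eq0.
pose r n := \sum_(j < n.+1) a j.
have rE n : n%:R * r n = \sum_(i < n) (1 + s i.+1) * r (n - i.+1)%N.
  exact: log_derivative_partial_sums.
have sD_ge0 k : (0 < k)%N -> 0 <= 1 + s k.
  by move=> /s_le1; rewrite ler_norml => /andP[]; lra.
have r0 : r 0%N = 1 by rewrite /r big_ord1.
have r_ge0 n : 0 <= r n.
  elim/ltn_ind: n => -[|n] IHn; first by rewrite r0.
  rewrite -(pmulr_rge0 (x := n.+1%:R)) ?ltr0n // rE.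
  apply: sumr_ge0 => i _; rewrite mulr_ge0 ?sD_ge0 ?IHn //.
  by rewrite subSS ltnS leq_subr.
have r_const n : (D <= n)%N -> r n = r D.
  move=> /subnK <-; elim: (n - D)%N => [|m IHm] //.
  by rewrite /r addSn big_ord_recr /= a_eq0 ?addr0 -?addSn ?leq_addl.
have rD_gt0 : 0 < r D.
  (* The even index [D.*2] is chosen because, for [D > 0], the summand ending in [r 0 = 1] has the
     strictly positive weight [1 + s D.*2]. *)
  rewrite -(r_const D.*2) -?addnn ?leq_addr // addnn.
  have [->|] := posnP D; first by rewrite r0.
  rewrite -double_gt0; have := odd_double D; case: D.*2 => // n odd_n _.
  rewrite -(pmulr_rgt0 (x := n.+1%:R)) ?ltr0n // rE big_ord_recr /= subnn r0.
  rewrite mulr1 ltr_wpDl ?sumr_ge0 // => [i _|].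
    by rewrite mulr_ge0 ?sD_ge0.
  by have := s_gtN1 n.+1 isT; rewrite odd_n; move=> /(_ isT); lra.
pose B := \sum_(j < D) `|r j - r D|.
have B_ge0 : 0 <= B by apply: sumr_ge0 => i _.
(* The term [D] covers [M < D]. For larger [M] only the values [r j] with [j < D] matter, each with
   weight at most 2. *)
exists (D%:R + 2 * B / r D) => M.
have [M_lt_D | D_le_M] := ltnP M D.
  rewrite ler_wpDr ?divr_ge0 ?mulr_ge0 ?(ltW rD_gt0) //.
  apply: le_trans (ler_norm_sum _ _ _) _.
  apply: le_trans (_ : \sum_(i < M) 1 <= _).
    by apply: ler_sum => i _; rewrite s_le1.
  by rewrite sumr_const card_ord ler_nat ltnW.
rewrite ler_wpDl // ler_pdivlMr // -[X in _ * X]gtr0_norm // -normrM.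
(* Since [r M = r D], the recurrence writes [M * r D] as a weighted sum of earlier values; replacing
   each value by its deviation from [r D] isolates the sum of the [s]. *)
have -> : (\sum_(i < M) s i.+1) * r D =
    - \sum_(i < M) (1 + s i.+1) * (r (M - i.+1)%N - r D).
  under [in RHS]eq_bigr do rewrite mulrBr.
  rewrite sumrB -rE r_const // -mulr_suml big_split /= sumr_const card_ord.
  by ring.
rewrite normrN; apply: le_trans (ler_norm_sum _ _ _) _.
apply: le_trans (_ : \sum_(i < M) 2 * `|r (M - i.+1)%N - r D| <= _).
  apply: ler_sum => i _; rewrite normrM ler_wpM2r // ger0_norm ?sD_ge0 //.
  by have := s_le1 i.+1 isT; rewrite ler_norml => /andP[]; lra.
rewrite -mulr_sumr ler_wpM2l //.
rewrite (reindex_inj rev_ord_inj) /=.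
under eq_bigr => i _ do rewrite subnSK // subKn 1?ltnW //.
rewrite /B -(big_mkord xpredT (fun j => `|r j - r D|)) (big_cat_nat _ D_le_M) //=.
rewrite big_mkord [X in _ + X]big_nat_cond [X in _ + X]big1 ?addr0 // => j.
by rewrite andbT => /andP[D_le_j _]; rewrite r_const // subrr normr0.
Qed.

(** * Monic polynomials and the Euler product *)

Section MonicPolynomials.
Variable K : finFieldType.

Definition monics n : seq {poly K} := [seq 'X^n + rVpoly v | v <- enum 'rV[K]_n].

Lemma size_monics n : size (monics n) = (#|K| ^ n)%N.
Proof. by rewrite size_map -cardE card_mx mul1n. Qed.

Lemma uniq_monics n : uniq (monics n).
Proof.
rewrite map_inj_uniq ?enum_uniq // => u v /addrI.
by move/(congr1 (@poly_rV K n)); rewrite !rVpolyK.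
Qed.

Lemma mem_monics n (f : {poly K}) :
  (f \in monics n) = (f \is monic) && (size f == n.+1).
Proof.
apply/mapP/andP => [[v _ ->]|[f_monic /eqP size_f]].
  have lt_v : (size (rVpoly v) < size ('X^n : {poly K}))%N.
    by rewrite size_polyXn ltnS size_poly.
  by rewrite monicE lead_coefDl // lead_coefXn size_polyDl // size_polyXn.
exists (poly_rV (f - 'X^n)); rewrite ?mem_enum // poly_rV_K; first by rewrite addrC subrK.
apply/leq_sizeP => j; rewrite leq_eqVlt coefB coefXn => /predU1P[<-|lt_nj].
  by move/monicP: f_monic; rewrite lead_coefE size_f /= eqxx => ->; rewrite subrr.
by rewrite gtn_eqF // subr0 nth_default // size_f.
Qed.

Lemma monics_divisible n d (g : {poly K}) : g \in monics d ->
  perm_eq [seq f <- monics n | g %| f]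
    (if (d <= n)%N then [seq g * h | h <- monics (n - d)] else [::]).
Proof.
rewrite mem_monics => /andP[g_monic /eqP size_g].
have g_neq0 := monic_neq0 g_monic.
apply: uniq_perm => [||f].
- exact/filter_uniq/uniq_monics.
- case: ifP => // _; rewrite map_inj_uniq ?uniq_monics //; exact: mulfI.
rewrite mem_filter mem_monics.
have [le_dn | lt_nd] := leqP d n; last first.
  apply/negP => /and3P[g_dvd f_monic /eqP size_f].
  have := dvdp_leq (monic_neq0 f_monic) g_dvd.
  by rewrite size_g size_f ltnS leqNgt lt_nd.
apply/and3P/mapP => [[/dvdpP[h ->] hg_monic /eqP size_hg]|[h]].
  have h_monic : h \is monic by rewrite -(monicMr h g_monic).
  exists h; last exact: mulrC.
  rewrite mem_monics h_monic /=.
  move: size_hg; rewrite size_monicM ?monic_neq0 // size_g addnS /= => /eqP.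
  by rewrite -{1}(subnK le_dn) -addSn eqn_add2r.
rewrite mem_monics => /andP[h_monic /eqP size_h] ->; split; first exact: dvdp_mulIl.
  by rewrite rpredM.
by rewrite size_monicM ?monic_neq0 // size_g size_h addnS /= addSn subnKC.
Qed.

Definition primes_of_degree d := [seq P <- monics d | irreducibleb P].

Lemma mem_primes_of_degree d P : (P \in primes_of_degree d) =
  [&& irreducibleb P, P \is monic & size P == d.+1].
Proof. by rewrite mem_filter mem_monics. Qed.

Lemma exists_irreducible_factor (f : {poly K}) : f \is monic -> (1 < size f)%N ->
  exists d, exists2 P, P \in primes_of_degree d & P %| f.
Proof.
have [n] := ubnP (size f); elim: n f => // n IHn f size_f f_monic f_gt1.
have [/irreducibleP f_irr | ] := boolP (irreducibleb f).
  exists (size f).-1, f => //; rewrite mem_primes_of_degree f_monic prednK ?eqxx ?andbT //.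
    exact/irreducibleP.
  exact: ltnW.
rewrite /irreducibleb f_gt1 /= negb_forall => /existsP[q].
rewrite negb_imply -ltnNge -dvdpE => /andP[q_dvd q_gt1].
have q_neq0 : (q : {poly K}) != 0 by rewrite -size_poly_gt0 ltnW.
have q_lt : (size q < size f)%N.
  by rewrite (leq_ltn_trans (size_npoly q)) // prednK // ltnW.
pose r := (lead_coef q)^-1 *: (q : {poly K}).
have lq_neq0 : (lead_coef q)^-1 != 0 by rewrite invr_eq0 lead_coef_eq0.
have size_r : size r = size q by rewrite size_scale.
have [||| d [P P_prime P_dvd]] := IHn r.
- by rewrite size_r (leq_trans q_lt).
- by rewrite monicE lead_coefZ mulVf ?lead_coef_eq0.
- by rewrite size_r.
by exists d, P => //; apply: dvdp_trans P_dvd _; rewrite dvdpZl.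
Qed.

(** The exponent of [P] in [f], counted through the divisors [P, ..., P^N]. For irreducible [P] and
    nonzero [f] the cutoff loses nothing once [N] reaches the degree of [f]. *)
Definition multiplicity (N : nat) (P f : {poly K}) :=
  (\sum_(m < N) ((P ^+ m.+1 %| f)%R : nat))%N.

Lemma prime_power_dvd_size d P m (f : {poly K}) : P \in primes_of_degree d ->
  f != 0 -> P ^+ m %| f -> (d * m < size f)%N.
Proof.
rewrite mem_primes_of_degree => /and3P[_ P_monic /eqP size_P] f_neq0.
by move/(dvdp_leq f_neq0); rewrite -[size _]prednK ?size_poly_gt0 ?monic_neq0 ?rpredX //
  size_exp size_P.
Qed.

(** Cancelling [P] shifts the counted powers by one. The bound on [size h] ensures that the top
    power does not divide [h], so the cutoff costs nothing. *)
Lemma multiplicity_mul_self N d P (h : {poly K}) : P \in primes_of_degree d ->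
  h != 0 -> (size h <= N)%N -> multiplicity N P (P * h) = (multiplicity N P h).+1.
Proof.
move=> P_prime h_neq0; case: N => [|N] le_N.
  by rewrite leqn0 size_poly_eq0 (negPf h_neq0) in le_N.
have := P_prime; rewrite mem_primes_of_degree => /and3P[/irreducibleP[P_gt1 _] P_monic /eqP size_P].
have P_neq0 := monic_neq0 P_monic.
have d_gt0 : (0 < d)%N by rewrite -ltnS -size_P.
rewrite /multiplicity big_ord_recl big_ord_recr /= expr1 dvdp_mulr // add1n.
have -> : (P ^+ N.+1 %| h) = false.
  apply/negP => /(prime_power_dvd_size P_prime h_neq0) /leq_trans /(_ le_N).
  by rewrite ltnNge leq_pmull.
rewrite addn0; congr _.+1; apply: eq_bigr => m _.
by rewrite /bump /= add1n exprS dvdp_mul2l.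
Qed.

Lemma multiplicity_mul_other N d d' P Q (h : {poly K}) :
  P \in primes_of_degree d -> Q \in primes_of_degree d' -> P != Q ->
  multiplicity N Q (P * h) = multiplicity N Q h.
Proof.
rewrite !mem_primes_of_degree => /and3P[/irreducibleP P_irr P_monic _].
move=> /and3P[/irreducibleP Q_irr Q_monic _] neq_PQ.
apply: eq_bigr => m _; rewrite Gauss_dvdpr // coprimep_expl //.
rewrite irreducible_poly_coprime //; apply: contra neq_PQ => Q_dvd.
have := Q_irr.1; rewrite ltnNge leq_eqVlt negb_or => /andP[Q_neq1 _].
by rewrite eq_sym -eqp_monic // P_irr.2.
Qed.

(** This stands in for unique factorization. Splitting off one irreducible factor changes no
    multiplicity but its own, which grows by one, so strong induction on the degree adds exactly the
    degree of that factor. *)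
Lemma sum_multiplicity N n f : f \in monics n -> (n <= N)%N ->
  (\sum_(d < N.+1) \sum_(P <- primes_of_degree d) d * multiplicity N P f = n)%N.
Proof.
elim/ltn_ind: n f => n IHn f; rewrite mem_monics => /andP[f_monic /eqP size_f] le_nN.
have [n_eq0 | n_gt0] := posnP n.
  rewrite big1 // => d _; rewrite big_seq big1 // => P P_prime.
  rewrite /multiplicity big1 ?muln0 // => m _.
  have [/dvdp_leq le_size|//] := boolP (P ^+ m.+1 %| f).
  have P_gt1 : (1 < size P)%N.
    by move: P_prime; rewrite mem_primes_of_degree => /and3P[/irreducibleP[]].
  have [P0 | P0] := boolP (P == 0); first by rewrite (eqP P0) size_poly0 in P_gt1.
  have := le_size (monic_neq0 f_monic); rewrite size_f n_eq0.
  rewrite -[size _]prednK ?size_poly_gt0 ?expf_neq0 // ltnS leqn0 size_exp.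
  by rewrite muln_eq0 /= orbF -subn1 subn_eq0 leqNgt P_gt1.
have [|d0 [P P_prime P_dvd]] := exists_irreducible_factor f_monic; first by rewrite size_f ltnS.
have := P_prime; rewrite mem_primes_of_degree => /and3P[/irreducibleP[P_gt1 _] P_monic /eqP size_P].
have d0_gt0 : (0 < d0)%N by rewrite -ltnS -size_P.
have P_monics : P \in monics d0 by rewrite mem_monics P_monic size_P /=.
have : f \in [seq f <- monics n | P %| f] by rewrite mem_filter P_dvd mem_monics f_monic size_f /=.
rewrite (perm_mem (monics_divisible n P_monics)); case: ifP => // le_d0n /mapP[h h_monics ->].
have := h_monics; rewrite mem_monics => /andP[h_monic /eqP size_h].
have lt_d0N : (d0 < N.+1)%N by rewrite ltnS (leq_trans le_d0n).
have h_small : (size h <= N)%N.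
  by rewrite size_h (leq_trans _ le_nN) // ltn_subLR // -[ltnLHS]add0n ltn_add2r.
rewrite -[RHS](subnKC le_d0n) -[in RHS](IHn (n - d0)%N _ h h_monics); last 2 first.
- by rewrite ltn_subLR // -[ltnLHS]add0n ltn_add2r.
- by rewrite (leq_trans (leq_subr _ _)).
rewrite (bigD1 (Ordinal lt_d0N)) //= [in RHS](bigD1 (Ordinal lt_d0N)) //= addnA.
congr (_ + _)%N.
  have P_uniq := filter_uniq (irreducibleb (R:=K)) (uniq_monics d0).
  rewrite (bigD1_seq P) //= [in RHS](bigD1_seq P) //= addnA.
  rewrite (multiplicity_mul_self P_prime (monic_neq0 h_monic) h_small) mulnS.
  congr (_ + _)%N; rewrite big_seq_cond [in RHS]big_seq_cond.
  apply: eq_bigr => Q /andP[Q_prime neq_QP].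
  by rewrite (multiplicity_mul_other N h P_prime Q_prime) // eq_sym.
apply: eq_bigr => d neq_d; rewrite big_seq [in RHS]big_seq; apply: eq_bigr => Q Q_prime.
rewrite (multiplicity_mul_other N h P_prime Q_prime) //; apply: contraNneq neq_d => eq_PQ.
move: Q_prime; rewrite -eq_PQ mem_primes_of_degree size_P => /and3P[_ _].
by rewrite -val_eqE /= eqSS eq_sym.
Qed.

End MonicPolynomials.

(** * Logarithmic derivative of the Euler product *)

Section EulerProduct.
Variables (K : finFieldType) (R : comNzRingType).

Lemma sum_multiples n d (G : nat -> nat -> R) : (0 < d)%N ->
  \sum_(m < n | (d * m.+1 <= n)%N) G m.+1 (d * m.+1)%N =
  \sum_(i < n | (d %| i.+1)%N) G (i.+1 %/ d)%N i.+1.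
Proof.
move=> d_gt0; rewrite [RHS]big_mkcond /=.
(* Both sides are sums of the array [H], supported where the degree [i.+1] equals [d * m.+1], taken
   in the two orders. *)
pose H (i m : nat) := if (d * m.+1 == i.+1)%N then G m.+1 (d * m.+1)%N else 0.
transitivity (\sum_(i < n) \sum_(m < n) H i m).
  rewrite exchange_big [LHS]big_mkcond /=; apply: eq_bigr => m _; rewrite /H -big_mkcond /=.
  have [le_n | gt_n] := leqP.
    have lt_n : ((d * m.+1).-1 < n)%N by rewrite prednK ?muln_gt0 ?d_gt0.
    rewrite (big_pred1 (Ordinal lt_n)) // => i.
    by rewrite /= -val_eqE /= -(eqSS i) prednK ?muln_gt0 ?d_gt0 // eq_sym.
  rewrite big1 // => i /eqP eq_i.
  by move: gt_n; rewrite eq_i ltnNge ltn_ord.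
apply: eq_bigr => i _; rewrite /H -big_mkcond /=.
case: ifP => [/dvdnP[[|m] eq_i]|ndvd]; first by rewrite mul0n in eq_i.
  have lt_n : (m < n)%N.
    by rewrite (leq_trans _ (ltn_ord i)) // eq_i leq_pmulr.
  rewrite (big_pred1 (Ordinal lt_n)) /= => [|j].
    by rewrite eq_i mulnK // mulnC.
  by rewrite /= -val_eqE /= eq_i [(m.+1 * d)%N]mulnC eqn_pmul2l.
by rewrite big1 // => m /eqP eq_i; rewrite -eq_i dvdn_mulr in ndvd.
Qed.

(* With [w P m = chi P ^+ m] this is the sum of Lambda * chi over the monic
   polynomials of degree k, Lambda being the von Mangoldt function. *)
Definition prime_power_sum (w : {poly K} -> nat -> R) k :=
  \sum_(d < k.+1 | (d %| k)%N) \sum_(P <- primes_of_degree K d)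
    d%:R * w P (k %/ d)%N.

Definition degree_sum (chi : {poly K} -> R) n := \sum_(f <- monics K n) chi f.

Lemma eq_prime_power_sum w1 w2 k : (forall P m, w1 P m = w2 P m) ->
  prime_power_sum w1 k = prime_power_sum w2 k.
Proof.
by move=> eq_w; do 2![apply: eq_bigr => ? _]; rewrite eq_w.
Qed.

Lemma prime_power_sum_linear (I : finType) (w : I -> {poly K} -> nat -> R) k :
  prime_power_sum (fun P m => \sum_i w i P m) k = \sum_i prime_power_sum (w i) k.
Proof.
rewrite /prime_power_sum exchange_big; apply: eq_bigr => d _ /=.
by rewrite exchange_big; apply: eq_bigr => P _; rewrite mulr_sumr.
Qed.

Lemma prime_power_sumZ c (w : {poly K} -> nat -> R) k :
  prime_power_sum (fun P m => c * w P m) k = c * prime_power_sum w k.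
Proof.
rewrite /prime_power_sum mulr_sumr; apply: eq_bigr => d _ /=.
by rewrite mulr_sumr; apply: eq_bigr => P _; rewrite mulrCA.
Qed.

Lemma degree_primes d P : P \in primes_of_degree K d -> (0 < d)%N.
Proof.
rewrite mem_primes_of_degree => /and3P[/irreducibleP[P_gt1 _] _ /eqP size_P].
by rewrite -ltnS -size_P.
Qed.

(** Double counting: for each monic [f] of degree [n], write [n] as the sum of [d * multiplicity]
    over primes and exchange the sums. Each [P^m] dividing [f] contributes [chi P ^+ m] times [chi]
    of the cofactor. *)
Lemma log_derivative_degree_sum (chi : {poly K} -> R) n :
  chi 1 = 1 -> {morph chi : f g / f * g} ->
  n%:R * degree_sum chi n =
    \sum_(i < n) prime_power_sum (fun P m => chi P ^+ m) i.+1
                 * degree_sum chi (n - i.+1).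
Proof.
move=> chi1 chiM.
have chiX P m : chi (P ^+ m) = chi P ^+ m.
  by elim: m => [|m IHm]; rewrite ?expr0 // !exprS chiM IHm.
transitivity (\sum_(d < n.+1) \sum_(P <- primes_of_degree K d)
    \sum_(m < n | (d * m.+1 <= n)%N)
       d%:R * chi P ^+ m.+1 * degree_sum chi (n - d * m.+1)%N).
  transitivity (\sum_(d < n.+1) \sum_(P <- primes_of_degree K d)
      \sum_(f <- monics K n) (d * multiplicity n P f)%:R * chi f).
    under eq_bigr do rewrite exchange_big; rewrite exchange_big /=.
    rewrite mulr_sumr big_seq [RHS]big_seq; apply: eq_bigr => f f_monics.
    rewrite -[in LHS](sum_multiplicity f_monics (leqnn n)) natr_sum mulr_suml.
    by apply: eq_bigr => d _; rewrite natr_sum mulr_suml.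
  apply: eq_bigr => d _; rewrite big_seq [RHS]big_seq; apply: eq_bigr => P P_prime.
  transitivity (\sum_(m < n) d%:R *
      \sum_(f <- monics K n | P ^+ m.+1 %| f) chi f).
    under eq_bigr do rewrite /multiplicity natrM natr_sum -mulrA mulr_suml mulr_sumr.
    rewrite exchange_big /=; apply: eq_bigr => m _; rewrite -mulr_sumr; congr (_ * _).
    by rewrite [RHS]big_mkcond; apply: eq_bigr => f _; case: ifP; rewrite ?mul1r ?mul0r.
  rewrite [RHS]big_mkcond; apply: eq_bigr => m _.
  have Pm_monics : P ^+ m.+1 \in monics K (d * m.+1).
    move: P_prime; rewrite mem_primes_of_degree mem_monics => /and3P[_ P_monic /eqP size_P].
    rewrite rpredX //= -[size _]prednK ?size_poly_gt0 ?expf_neq0 ?monic_neq0 //.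
    by rewrite size_exp size_P.
  rewrite -big_filter (perm_big _ (monics_divisible n Pm_monics)) /=.
  case: ifP => _; last by rewrite big_nil mulr0.
  rewrite big_map -mulrA /degree_sum; congr (_ * _).
  by rewrite mulr_sumr; apply: eq_bigr => f _; rewrite chiM chiX.
(* The powers [P^m] are regrouped by their degree [d * m = i.+1]. *)
transitivity (\sum_(d < n.+1) \sum_(P <- primes_of_degree K d)
    \sum_(i < n | (d %| i.+1)%N)
       d%:R * chi P ^+ (i.+1 %/ d) * degree_sum chi (n - i.+1)%N).
  apply: eq_bigr => d _; rewrite big_seq [RHS]big_seq; apply: eq_bigr => P P_prime.
  exact: (sum_multiples n (fun m k => d%:R * chi P ^+ m * degree_sum chi (n - k)%N)
           (degree_primes P_prime)).
under eq_bigr do rewrite exchange_big /=.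
rewrite (exchange_big_dep xpredT) //=; apply: eq_bigr => i _.
rewrite /prime_power_sum mulr_suml.
rewrite (big_ord_widen_cond n.+1 (fun d => d %| i.+1)%N
  (fun d => (\sum_(P <- primes_of_degree K d) d%:R * chi P ^+ (i.+1 %/ d)%N)
            * degree_sum chi (n - i.+1)%N)) ?ltnS //.
apply: eq_big => [d|d _]; last by rewrite mulr_suml.
by rewrite andb_idr // => /(dvdn_leq (ltn0Sn i)); rewrite -ltnS.
Qed.

End EulerProduct.

(** * Quadratic characters and irreducible polynomials with prescribed signs *)

Section QuadraticCharacter.
Variable K : finFieldType.
Hypothesis two_neq0 : 2%:R != 0 :> K.

(** Euler's criterion serves as the definition; the values lie in [rat] so that character sums can
    be estimated. *)
Definition quadratic_char (x : K) : rat :=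
  if x == 0 then 0 else if x ^+ #|K|.-1./2 == 1 then 1 else -1.

Local Notation eta := quadratic_char.

Lemma card_odd : odd #|K|.
Proof.
apply: contraNT two_neq0 => even_K.
have := expf_card (-1 : K); rewrite -signr_odd (negPf even_K) expr0 => eq1.
by rewrite -[2%:R]/(1 + 1) {1}eq1 addNr.
Qed.

Lemma card_pred_half : #|K|.-1./2.*2 = #|K|.-1.
Proof.
have := card_odd; rewrite -(ltn_predK (finNzRing_gt1 K)) /= => even_K.
by rewrite even_halfK.
Qed.

Lemma expf_card_pred (x : K) : x != 0 -> x ^+ #|K|.-1 = 1.
Proof.
move=> x_neq0; apply: (mulfI x_neq0).
by rewrite -exprS (ltn_predK (finNzRing_gt1 K)) expf_card mulr1.
Qed.

Lemma euler_power_eq (x : K) : x != 0 ->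
  (x ^+ #|K|.-1./2 == 1) || (x ^+ #|K|.-1./2 == -1).
Proof.
by move=> x_neq0; rewrite -eqf_sqr expr1n -exprM muln2 card_pred_half expf_card_pred.
Qed.

Lemma quadratic_char0 : eta 0 = 0. Proof. by rewrite /eta eqxx. Qed.

Lemma quadratic_char1 : eta 1 = 1.
Proof. by rewrite /eta oner_eq0 expr1n eqxx. Qed.

Lemma quadratic_charM : {morph eta : x y / x * y}.
Proof.
have N1_neq1 : (-1 == 1 :> K) = false.
  by apply: negbTE; rewrite eq_sym -subr_eq0 opprK.
move=> x y; rewrite /eta mulf_eq0.
have [_|x_neq0] := eqVneq x 0; first by rewrite mul0r.
have [_|y_neq0] := eqVneq y 0; first by rewrite mulr0.
rewrite exprMn /=; case/orP: (euler_power_eq x_neq0) => /eqP ->;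
  case/orP: (euler_power_eq y_neq0) => /eqP ->;
  by rewrite ?mulN1r ?mul1r ?opprK ?N1_neq1 ?eqxx ?mulrN ?mulr1.
Qed.

Lemma quadratic_char_prod (I : Type) (r : seq I) (F : I -> K) :
  eta (\prod_(i <- r) F i) = \prod_(i <- r) eta (F i).
Proof. exact: (big_morph _ quadratic_charM quadratic_char1). Qed.

Lemma quadratic_charX x n : eta (x ^+ n) = eta x ^+ n.
Proof.
by elim: n => [|n IHn]; rewrite ?expr0 ?quadratic_char1 // !exprS quadratic_charM IHn.
Qed.

Lemma quadratic_char_square x : x != 0 -> eta (x ^+ 2) = 1.
Proof.
move=> x_neq0; rewrite /eta expf_eq0 /= (negPf x_neq0).
by rewrite -exprM mul2n card_pred_half expf_card_pred // eqxx.
Qed.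

Lemma quadratic_char_neq0 x : x != 0 -> eta x = 1 \/ eta x = -1.
Proof. by rewrite /eta => /negPf->; case: ifP; [left | right]. Qed.

Lemma norm_quadratic_char_le1 x : `|eta x| <= 1.
Proof.
have [->|/quadratic_char_neq0[] ->] := eqVneq x 0;
  by rewrite ?quadratic_char0 ?normrN ?normr1 ?normr0.
Qed.

(** Otherwise [X^((q-1)/2) - 1] would vanish at all [q - 1] nonzero elements, more than its degree
    allows. *)
Lemma exists_nonsquare : exists2 z : K, z != 0 & eta z = -1.
Proof.
have [/existsP[z /andP[z_neq0 z_neq1]] | ] :=
    boolP [exists z : K, (z != 0) && (z ^+ #|K|.-1./2 != 1)].
  by exists z; rewrite // /eta (negPf z_neq0) (negPf z_neq1).
rewrite negb_exists => /forallP all1.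
have h_gt0 : (0 < #|K|.-1./2)%N.
  rewrite -double_gt0 card_pred_half -subn1 subn_gt0; exact: finNzRing_gt1.
have := max_poly_roots (p := 'X^(#|K|.-1./2) - 1) (rs := enum (predC1 (0 : K))).
rewrite -size_poly_gt0 size_XnsubC // enum_uniq -cardE cardC1 => /(_ isT) H.
have : (#|K|.-1 < (#|K|.-1./2).+1)%N.
  apply: H => //; apply/allP => z; rewrite mem_enum => z_neq0.
  have := all1 z; rewrite negb_and negbK (negPf z_neq0) /= negbK => /eqP z1.
  by rewrite /root !hornerE z1 subrr.
by rewrite ltnS -{1}card_pred_half -addnn -{3}[_./2]addn0 leq_add2l leqNgt h_gt0.
Qed.

(** The quadratic Dirichlet character modulo the product of the [X - b], [b] in [T]; it is 0 when
    [f] vanishes somewhere on [T]. *)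
Definition set_char (T : {set K}) (f : {poly K}) : rat := \prod_(b in T) eta f.[b].

Lemma set_char1 T : set_char T 1 = 1.
Proof. by rewrite /set_char big1 // => b _; rewrite hornerC quadratic_char1. Qed.

Lemma set_charM T : {morph set_char T : f g / f * g}.
Proof.
move=> f g; rewrite /set_char -big_split; apply: eq_bigr => b _.
by rewrite hornerM quadratic_charM.
Qed.

Lemma set_char0 f : set_char set0 f = 1.
Proof. by rewrite /set_char big_set0. Qed.

Lemma norm_set_char_le1 T f : `|set_char T f| <= 1.
Proof.
rewrite /set_char normr_prod; apply: prodr_ile1 => b _.
by rewrite normr_ge0 norm_quadratic_char_le1.
Qed.

(* Multiplying the value at b by a nonsquare while keeping all other values
   permutes the monic polynomials of degree n >= #|K|. *)
Lemma degree_sum_set_char_eq0 (T : {set K}) n : T != set0 -> (#|K| <= n)%N ->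
  degree_sum (set_char T) n = 0.
Proof.
case/set0Pn => b bT le_n; have [z z_neq0 eta_z] := exists_nonsquare.
(* As a function [ell] is the indicator of [b]; its degree is below [n], so adding multiples of it
   preserves monic polynomials of degree [n]. *)
pose ell : {poly K} := 1 - ('X - b%:P) ^+ #|K|.-1.
have K_gt1 := finNzRing_gt1 K.
have ell_b : ell.[b] = 1.
  by rewrite !hornerE subrr expr0n -subn1 subn_eq0 leqNgt K_gt1 subr0.
have ell_c c : c != b -> ell.[c] = 0.
  by move=> neq_cb; rewrite !hornerE expf_card_pred ?subr_eq0 // subrr.
have size_ell : (size ell <= n)%N.
  rewrite (leq_trans (size_polyD _ _)) // geq_max size_poly1 size_polyN size_exp_XsubC.
  by rewrite prednK ?(ltnW K_gt1) // le_n (leq_trans _ le_n) // ltnW.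
pose twist (t : K) (f : {poly K}) := f + ((t - 1) * f.[b]) *: ell.
have twist_b t f : (twist t f).[b] = t * f.[b] by rewrite hornerD hornerZ ell_b; ring.
have twist_c t f c : c != b -> (twist t f).[c] = f.[c].
  by move=> neq_cb; rewrite hornerD hornerZ ell_c // mulr0 addr0.
have twistK t t' : t' * t = 1 -> cancel (twist t) (twist t').
  move=> t'tK f; rewrite {1}/twist twist_b /twist -addrA -scalerDl.
  suff -> : (t - 1) * f.[b] + (t' - 1) * (t * f.[b]) = 0 by rewrite scale0r addr0.
  by transitivity ((t' * t - 1) * f.[b]); [ring | rewrite t'tK subrr mul0r].
have twist_monics t f : f \in monics K n -> twist t f \in monics K n.
  rewrite !mem_monics => /andP[f_monic /eqP size_f].
  have lt_f : (size (((t - 1) * f.[b]) *: ell) < size f)%N.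
    by rewrite size_f ltnS (leq_trans (size_scale_leq _ _)).
  by rewrite monicE lead_coefDl // (monicP f_monic) size_polyDl // size_f !eqxx.
have zVz : z^-1 * z = 1 by rewrite mulVf.
have perm : perm_eq (monics K n) [seq twist z f | f <- monics K n].
  apply: uniq_perm; rewrite ?uniq_monics //.
    by rewrite map_inj_uniq ?uniq_monics //; apply: can_inj (twistK _ _ zVz).
  move=> f; apply/idP/mapP => [f_monics|[g g_monics ->]]; last exact: twist_monics.
  exists (twist z^-1 f); first exact: twist_monics.
  by rewrite twistK // mulfV.
have twist_char f : set_char T (twist z f) = - set_char T f.
  rewrite /set_char (bigD1 b) //= [in RHS](bigD1 b) //= twist_b quadratic_charM eta_z.
  rewrite !mulN1r -mulNr; congr (_ * _).
  by apply: eq_bigr => c /andP[_ neq_cb]; rewrite twist_c.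
suff : degree_sum (set_char T) n = - degree_sum (set_char T) n by lra.
rewrite {1}/degree_sum (perm_big _ perm) big_map /degree_sum -sumrN.
by apply: eq_bigr => f _; rewrite twist_char.
Qed.

End QuadraticCharacter.

(** * Irreducible polynomials with prescribed signs *)

Section PrescribedSigns.
Variable K : finFieldType.
Hypothesis two_neq0 : 2%:R != 0 :> K.

Local Notation q := (#|K|%:R : rat).
Local Notation eta := (@quadratic_char K).

Lemma q_gt0 : 0 < q. Proof. by rewrite ltr0n ltnW // finNzRing_gt1. Qed.

Lemma degree_sum_0 (chi : {poly K} -> rat) : chi 1 = 1 -> degree_sum chi 0 = 1.
Proof.
move=> chi1; rewrite /degree_sum (perm_big [:: 1]) ?big_seq1 //.
apply: uniq_perm; rewrite ?uniq_monics // => f; rewrite mem_monics inE.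
apply/andP/eqP => [[f_monic /size_poly1P[a _ f_a]]|->]; last first.
  by rewrite monic1 size_poly1.
by move: f_monic; rewrite f_a monicE lead_coefC => /eqP ->.
Qed.

Lemma normalized_log_derivative (chi : {poly K} -> rat) n :
  chi 1 = 1 -> {morph chi : f g / f * g} ->
  n%:R * (degree_sum chi n / q ^+ n) =
    \sum_(i < n) (prime_power_sum (fun P m => chi P ^+ m) i.+1 / q ^+ i.+1) *
                 (degree_sum chi (n - i.+1) / q ^+ (n - i.+1)).
Proof.
move=> chi1 chiM; rewrite mulrA log_derivative_degree_sum // mulr_suml.
apply: eq_bigr => i _; rewrite mulrACA -invfM -exprD subnKC //.
Qed.

(** For the trivial character every normalized degree sum is 1, so the recurrence gives partial sums
    equal to [n]; consecutive differences are then 1. *)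
Lemma prime_power_sum_1 k : (0 < k)%N ->
  prime_power_sum (K := K) (fun _ _ => 1 : rat) k = q ^+ k.
Proof.
have q_neq0 : q != 0 by rewrite gt_eqF ?q_gt0.
have total n : \sum_(i < n) (prime_power_sum (K := K) (fun _ _ => 1 : rat) i.+1 / q ^+ i.+1)
    = n%:R.
  have sum1 m : degree_sum (fun _ : {poly K} => 1 : rat) m / q ^+ m = 1.
    rewrite /degree_sum big_const_seq count_predT size_monics iter_addr_0 natrX.
    by rewrite mulfV // expf_neq0.
  have := @normalized_log_derivative (fun=> 1) n (erefl _).
  rewrite sum1 mulr1 => ->; last by move=> *; rewrite mulr1.
  apply: eq_bigr => i _; rewrite sum1 mulr1; congr (_ / _).
  by apply: eq_prime_power_sum => P m; rewrite expr1n.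
case: k => // k _; have := total k.+1; rewrite big_ord_recr /= total -natr1 => /addrI.
by move=> eq1; rewrite -[LHS](divfK (expf_neq0 k.+1 q_neq0)) eq1 mul1r.
Qed.

Lemma norm_prime_power_sum_le (chi : {poly K} -> rat) k : (0 < k)%N ->
  (forall f, `|chi f| <= 1) ->
  `|prime_power_sum (fun P m => chi P ^+ m) k| <= q ^+ k.
Proof.
move=> k_gt0 chi_le1; rewrite -prime_power_sum_1 //.
do 2![apply: le_trans (ler_norm_sum _ _ _) _; apply: ler_sum => ? _].
rewrite normrM normr_nat ler_wpM2l // normrX.
by rewrite exprn_ile1.
Qed.

(** Adding the trivial character makes all summands nonnegative. The prime [X] has degree 1 and
    enters with the even exponent [k], so its summand is at least 1; this makes the inequality
    strict. *)
Lemma even_prime_power_sum_gt (chi : {poly K} -> rat) k : (0 < k)%N -> ~~ odd k ->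
  (forall f, `|chi f| <= 1) ->
  - q ^+ k < prime_power_sum (fun P m => chi P ^+ m) k.
Proof.
move=> k_gt0 even_k chi_le1; rewrite -prime_power_sum_1 // -subr_gt0 opprK.
rewrite /prime_power_sum -big_split /=.
under eq_bigr do rewrite -big_split /=.
have summand_ge0 d P m : 0 <= d%:R * chi P ^+ m + d%:R * 1 :> rat.
  rewrite -mulrDr mulr_ge0 //.
  have : `|chi P ^+ m| <= 1 by rewrite normrX exprn_ile1.
  by rewrite ler_norml => /andP[]; lra.
have lt_1k : (1 < k.+1)%N by rewrite ltnS.
rewrite (bigD1 (Ordinal lt_1k)) ?dvd1n //=.
rewrite ltr_pwDl ?sumr_ge0 // => [|d _]; last by rewrite sumr_ge0.
have X_prime : 'X \in primes_of_degree K 1.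
  rewrite mem_primes_of_degree monicX size_polyX eqxx !andbT.
  apply/irreducibleP; rewrite -[X in irreducible_poly X]subr0 -polyC0.
  exact: irredp_XsubC.
rewrite (bigD1_seq 'X) ?filter_uniq ?uniq_monics //=.
rewrite ltr_pwDl ?sumr_ge0 // divn1 !mul1r ltr_wpDl //.
by rewrite -(even_halfK even_k) -muln2 exprM sqr_ge0.
Qed.

Lemma bounded_character_sum (T : {set K}) : T != set0 -> exists C, forall M,
  `|\sum_(i < M) prime_power_sum (fun P m => set_char T P ^+ m) i.+1 / q ^+ i.+1| <= C.
Proof.
move=> T_neq0.
have qk_gt0 k : 0 < q ^+ k by rewrite exprn_gt0 ?q_gt0.
apply: (@nonvanishing_bounds_partial_sums _
  (fun n => degree_sum (set_char T) n / q ^+ n)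
  (fun k => prime_power_sum (fun P m => set_char T P ^+ m) k / q ^+ k) #|K|).
- by rewrite degree_sum_0 ?set_char1 // expr0 divr1.
- by move=> n; apply: normalized_log_derivative (set_char1 _) (set_charM _ _).
- move=> k k_gt0; rewrite normrM normfV (gtr0_norm (qk_gt0 k)) ler_pdivrMr // mul1r.
  exact: norm_prime_power_sum_le (norm_set_char_le1 _).
- move=> k k_gt0 even_k; rewrite ltr_pdivlMr // mulN1r.
  exact: even_prime_power_sum_gt (norm_set_char_le1 _).
- by move=> n le_n; rewrite degree_sum_set_char_eq0 ?mul0r.
Qed.

(** A detector of the sign pattern -1 on [A], +1 elsewhere: for odd [m] and [P] without roots in [K]
    it is [2^q] if the pattern holds and 0 otherwise. *)
Definition sign_weight (A : {set K}) (P : {poly K}) m : rat :=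
  \prod_b (1 + (-1) ^+ (b \in A) * eta P.[b] ^+ m).

Lemma sign_weight_expand A P m : sign_weight A P m =
  \sum_(T : {set K}) (\prod_(b in T) (-1) ^+ (b \in A)) * set_char T P ^+ m.
Proof.
rewrite /sign_weight; under eq_bigr do rewrite addrC.
rewrite bigA_distr; apply: eq_bigr => T _.
rewrite /set_char -prodrXl -big_split /= -big_mkcond; apply: eq_bigr => b _.
by [].
Qed.

(** Expanding over subsets [T], the empty set gives the trivial character and contributes exactly
    [M], while every other [T] contributes a bounded amount. *)
Lemma sum_sign_weight_lower_bound A : exists C, forall M,
  M%:R - C <= \sum_(i < M) prime_power_sum (sign_weight A) i.+1 / q ^+ i.+1.
Proof.
have [C C_bound] : exists C : {set K} -> rat, forall T, T != set0 -> forall M,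
   `|\sum_(i < M) prime_power_sum (fun P m => set_char T P ^+ m) i.+1 / q ^+ i.+1| <= C T.
  apply: (fin_all_exists (P := fun T c => T != set0 -> forall M, _ <= c)) => T.
  have [->|/bounded_character_sum[c c_bound]] := eqVneq T set0; first by exists 0.
  by exists c.
exists (\sum_(T | T != set0) C T) => M.
pose c (T : {set K}) : rat := \prod_(b in T) (-1) ^+ (b \in A).
have norm_c T : `|c T| = 1.
  by rewrite /c normr_prod big1 // => b _; rewrite normrX normrN1 expr1n.
have -> : \sum_(i < M) prime_power_sum (sign_weight A) i.+1 / q ^+ i.+1 =
    \sum_T c T * \sum_(i < M) prime_power_sum (fun P m => set_char T P ^+ m) i.+1 / q ^+ i.+1.
  under [RHS]eq_bigr do rewrite mulr_sumr; rewrite exchange_big /=.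
  apply: eq_bigr => i _; rewrite (eq_prime_power_sum _ (sign_weight_expand A)).
  rewrite prime_power_sum_linear mulr_suml; apply: eq_bigr => T _.
  by rewrite prime_power_sumZ mulrA.
rewrite [leRHS](bigD1 set0) //= lerD //.
  rewrite /c big_set0 mul1r -[X in X%:R]card_ord -sumr_const; apply: ler_sum => i _.
  rewrite -(@prime_power_sum_1 i.+1) //.
  rewrite (@eq_prime_power_sum _ _ _ (fun _ _ => 1)) => [|P m]; last by rewrite set_char0 expr1n.
  by rewrite mulfV // prime_power_sum_1 // expf_neq0 ?gt_eqF ?q_gt0.
rewrite -sumrN; apply: ler_sum => T T_neq0.
by have := C_bound T T_neq0 M; rewrite -[X in X <= _]mul1r -(norm_c T) -normrM ler_norml => /andP[].
Qed.

Lemma sum_geometric_le1 (x : rat) M : 0 <= x -> x * 2 <= 1 ->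
  \sum_(i < M) x ^+ i.+1 <= 1.
Proof.
move=> x_ge0 x_le; suff: \sum_(i < M) x ^+ i.+1 <= 1 - x ^+ M.
  by have := exprn_ge0 M x_ge0; lra.
elim: M => [|M IHM]; first by rewrite big_ord0 expr0 subrr.
rewrite big_ord_recr /= (le_trans (lerD IHM (lexx _))) //.
have : x ^+ M.+1 * 2 <= x ^+ M.
  by rewrite exprSr -mulrA ler_piMr // exprn_ge0.
by lra.
Qed.

Lemma sign_weight_range A P m : 0 <= sign_weight A P m <= 2 ^+ #|K|.
Proof.
have factor b : 0 <= 1 + (-1) ^+ (b \in A) * eta P.[b] ^+ m <= 2.
  have : `|(-1) ^+ (b \in A) * eta P.[b] ^+ m| <= 1.
    by rewrite normrM normrX normrN1 expr1n mul1r normrX exprn_ile1 ?norm_quadratic_char_le1.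
  by rewrite ler_norml => /andP[]; lra.
rewrite /sign_weight prodr_ge0 => [/=|b _]; last by case/andP: (factor b).
by rewrite -prodr_const; apply: ler_prod.
Qed.

(** For odd [m] the factor at a point of wrong sign vanishes. For even [m] the factor at any point
    of [A] vanishes, whence the need for a nonempty [A]. *)
Lemma sign_weight_eq0 A P m : A != set0 -> (forall b, P.[b] != 0) ->
  ~~ [forall b, eta P.[b] == (-1) ^+ (b \in A)] -> sign_weight A P m = 0.
Proof.
move=> /set0Pn[a aA] P_neq0; rewrite negb_forall => /existsP[b eta_b]; apply/eqP.
have sqr1 x : eta P.[x] ^+ 2 = 1.
  by case: (quadratic_char_neq0 (P_neq0 x)) => ->; rewrite ?sqrrN expr1n.
have [odd_m | even_m] := boolP (odd m); apply/prodf_eq0.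
  exists b => //; rewrite -(odd_double_half m) odd_m -mul2n exprS exprM sqr1 expr1n mulr1.
  move: eta_b; case: (quadratic_char_neq0 (P_neq0 b)) => ->;
    by case: (b \in A); rewrite ?expr1 ?expr0 ?eqxx // ?mulN1r ?opprK ?mulr1 ?mul1r ?addrN.
exists a => //; rewrite aA expr1 -(even_halfK even_m) -mul2n exprM sqr1 expr1n mulr1.
by rewrite addrN.
Qed.

(** If no prime of large degree had the pattern, only finitely many primes would carry weight; the
    sums divided by [q^k] would stay bounded, against the lower bound [M - C]. *)
Theorem irreducible_with_prescribed_signs (A : {set K}) N : A != set0 ->
  exists P : {poly K}, [/\ irreducible_poly P, P \is monic, (N < size P)%N &
    forall b, eta P.[b] = (-1) ^+ (b \in A)].
Proof.
move=> A_neq0; have [C lower] := sum_sign_weight_lower_bound A.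
pose good P := [forall b, eta P.[b] == (-1) ^+ (b \in A)].
pose c d : rat := \sum_(P <- primes_of_degree K d) d%:R * 2 ^+ #|K|.
have c_ge0 d : 0 <= c d by apply: sumr_ge0 => P _; rewrite mulr_ge0 ?exprn_ge0.
(* [B] bounds the total contribution of primes of degree at most [N.+1]. The remaining primes have
   degree at least 2, hence no roots in [K]. *)
pose B := \sum_(d < N.+2) c d.
pose M := Num.bound `|C + B|.
have [/existsP[d /andP[lt_Nd /hasP[P P_prime /forallP P_good]]] | bad] :=
    boolP [exists d : 'I_M.+1, (N.+1 < d)%N && has good (primes_of_degree K d)].
  move: P_prime; rewrite mem_primes_of_degree => /and3P[/irreducibleP P_irr P_monic /eqP size_P].
  exists P; split=> // [|b]; last exact/eqP/P_good.
  by rewrite size_P ltnS ltnW // ltnW.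
have weight_bound k : (k <= M)%N -> prime_power_sum (sign_weight A) k <= B.
  move=> le_kM; pose F d := if (d < N.+2)%N then c d else 0.
  apply: le_trans (_ : \sum_(d < k.+1) F d <= _).
    rewrite /prime_power_sum big_mkcond; apply: ler_sum => d _.
    have [dvd_dk|_] := ifP; last by rewrite /F; case: ifP.
    rewrite /F; case: ifP => [_|ge_N]; rewrite /c big_seq.
      rewrite [leRHS]big_seq; apply: ler_sum => P _.
      by rewrite ler_wpM2l //; case/andP: (sign_weight_range A P (k %/ d)).
    rewrite big1 // => P P_prime.
    have lt_dM : (d < M.+1)%N by rewrite (leq_trans (ltn_ord d)).
    move: bad; rewrite negb_exists => /forallP /(_ (Ordinal lt_dM)) /=.
    have lt_Nd : (N.+1 < d)%N by rewrite ltnNge -ltnS ge_N.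
    rewrite lt_Nd /= -all_predC => /allP /(_ P P_prime) /= P_bad.
    move: P_prime; rewrite mem_primes_of_degree => /and3P[/irreducibleP P_irr P_monic /eqP size_P].
    rewrite sign_weight_eq0 ?mulr0 // => b; apply/negP => root_b.
    have : 'X - b%:P %| P by rewrite dvdp_XsubCl.
    move/(P_irr.2 _); rewrite size_XsubC => /(_ isT) /eqp_size.
    rewrite size_XsubC size_P => -[d1].
    by rewrite -d1 in lt_Nd.
  rewrite /B (big_ord_widen (k.+1 + N.+2) F) ?leq_addr //.
  rewrite (big_ord_widen (k.+1 + N.+2) c) ?leq_addl //.
  rewrite [leLHS]big_mkcond [leRHS]big_mkcond; apply: ler_sum => d _.
  by rewrite /F; case: ifP; case: ifP.
have B_ge0 : 0 <= B by apply: sumr_ge0.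
have upper : \sum_(i < M) prime_power_sum (sign_weight A) i.+1 / q ^+ i.+1 <= B.
  apply: le_trans (_ : \sum_(i < M) B * q^-1 ^+ i.+1 <= _).
    apply: ler_sum => i _; rewrite exprVn ler_wpM2r ?weight_bound //.
    by rewrite invr_ge0 exprn_ge0 // ltW ?q_gt0.
  rewrite -mulr_sumr ler_piMr // sum_geometric_le1 ?invr_ge0 ?(ltW q_gt0) //.
  by rewrite mulrC ler_pdivrMr ?q_gt0 // mul1r ler_nat finNzRing_gt1.
have : `|C + B| < M%:R by apply: archi_boundP; exact: normr_ge0.
have := lower M; have := ler_norm (C + B); lra.
Qed.

End PrescribedSigns.

(** * Biquadratic polynomials, reciprocity and descent *)

Section BiquadraticIrreducibility.
Variable k : fieldType.

(** The equations compare coefficients in a factorization of [e (X^2 + a)^2 + g] into two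
    quadratics. Made monic, these are [X^2 + tX + s] and [X^2 - tX + v] with [t (v - s) = 0]: if
    [t = 0] then [y = s - a] works, and if [v = s] then [y = s]. *)
Lemma quadratic_factors_value (e a g s0 s1 s2 r0 r1 r2 : k) : s2 != 0 -> r2 != 0 ->
  s0 * r0 = e * a ^+ 2 + g -> s0 * r1 + s1 * r0 = 0 ->
  s0 * r2 + (s1 * r1 + s2 * r0) = e * a + e * a ->
  s1 * r2 + s2 * r1 = 0 -> s2 * r2 = e ->
  exists y, e * y ^+ 2 = - g \/ e * y ^+ 2 = e * a ^+ 2 + g.
Proof.
move=> s2_neq0 r2_neq0 E0 E1 E2 E3 E4.
pose s := s0 / s2; pose t := s1 / s2; pose v := r0 / r2.
have s0E : s0 = s * s2 by rewrite divfK.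
have s1E : s1 = t * s2 by rewrite divfK.
have r0E : r0 = v * r2 by rewrite divfK.
have r1E : r1 = - t * r2.
  by apply: (mulfI s2_neq0); apply: (addrI (s1 * r2)); rewrite E3 s1E; ring.
have e_neq0 : e != 0 by rewrite -E4 mulf_neq0.
have E0' : e * (s * v) = e * a ^+ 2 + g by rewrite -E0 s0E r0E -E4; ring.
have E1' : t * (v - s) = 0.
  by apply: (mulfI e_neq0); rewrite mulr0 -E1 s0E s1E r0E r1E -E4; ring.
have E2' : s + v - t ^+ 2 = a + a.
  by apply: (mulfI e_neq0); rewrite [RHS]mulrDr -E2 s0E s1E r0E r1E -E4; ring.
move/eqP: E1'; rewrite mulf_eq0 subr_eq0 => /orP[/eqP t0|/eqP vs].
  have vE : v = a + a - s by rewrite -E2' t0; ring.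
  have gE : g = e * (s * v) - e * a ^+ 2 by rewrite E0'; ring.
  by exists (s - a); left; rewrite gE vE; ring.
by exists s; right; rewrite -E0' vs; ring.
Qed.

(* A factor of degree 1 or 3 yields y = x^2 + a for a root x, and a factorization
   (X^2 + tX + s)(X^2 - tX + v) yields t (v - s) = 0, hence y = s or y = s - a. *)
Lemma biquadratic_irreducible (e a g : k) : e != 0 ->
  (forall y, e * y ^+ 2 != - g) -> (forall y, e * y ^+ 2 != e * a ^+ 2 + g) ->
  irreducible_poly (e%:P * ('X^2 + a%:P) ^+ 2 + g%:P).
Proof.
move=> e_neq0 nonsquare1 nonsquare2; set f := _ + _.
have f_coef : f = Poly [:: e * a ^+ 2 + g; 0; e * a + e * a; 0; e].
  by rewrite /= !cons_poly_def /f expr2 !(polyCD, polyCM); ring.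
have size_f : size f = 5 by rewrite f_coef (PolyK (c := 0)).
have f_neq0 : f != 0 by rewrite -size_poly_gt0 size_f.
have no_root x : ~~ root f x.
  have -> : root f x = (e * (x ^+ 2 + a) ^+ 2 + g == 0).
    by rewrite /root /f !hornerE; congr (_ == _); ring.
  by rewrite addr_eq0 nonsquare1.
have no_linear_factor r : r %| f -> size r <> 2%N.
  move=> r_dvd /poly2_root[x root_x].
  have := no_root x; rewrite -dvdp_XsubCl (dvdp_trans _ r_dvd) //.
  by rewrite dvdp_XsubCl.
split=> [|r size_r r_dvd]; first by rewrite size_f.
rewrite -dvdp_size_eqp // size_f.
have /dvdpP[s f_eq] := r_dvd.
have s_dvd : s %| f by rewrite f_eq dvdp_mulIl.
have [s_neq0 r_neq0] : s != 0 /\ r != 0.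
  by apply/andP; rewrite -negb_or -mulf_eq0 -f_eq.
have size_sr : (size s + size r = 6)%N.
  have := size_mul s_neq0 r_neq0; rewrite -f_eq size_f.
  by rewrite -[size s]prednK ?size_poly_gt0 //= addSn /= => <-.
have r_neq2 := no_linear_factor r r_dvd.
have s_neq2 := no_linear_factor s s_dvd.
have s_gt0 : (0 < size s)%N by rewrite size_poly_gt0.
have r_gt0 : (0 < size r)%N by rewrite size_poly_gt0.
have [->|[size_r3 size_s3]] : size r = 5 \/ size r = 3 /\ size s = 3%N.
- move: size_r r_neq2 s_neq2 size_sr s_gt0 r_gt0.
  by move: (size r) (size s) => m n; lia.
- by [].
have lead_r : r`_2 != 0 by have := lead_coef_eq0 r; rewrite lead_coefE size_r3 /= => ->.
have lead_s : s`_2 != 0 by have := lead_coef_eq0 s; rewrite lead_coefE size_s3 /= => ->.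
have coef0 (h : {poly k}) i : size h = 3%N -> h`_i.+3 = 0.
  by move=> size_h; rewrite nth_default // size_h.
have coef_sr i : (s * r)`_i = f`_i by rewrite -f_eq.
have := (coef_sr 0, coef_sr 1, coef_sr 2, coef_sr 3, coef_sr 4)%N.
rewrite f_coef !coef_Poly /= !coefM !big_ord_recl !big_ord0 /= /bump /= !coef0 //.
rewrite ?(mul0r, mulr0, addr0, add0r) ?subSS ?subn0 ?addn0 => -[[[[E0 E1] E2] E3] E4].
rewrite -[(1 + 1)%N]/2%N in E2 E3 E4.
have [y] := quadratic_factors_value lead_s lead_r E0 E1 E2 E3 E4.
by case=> /eqP; [rewrite (negPf (nonsquare1 y)) | rewrite (negPf (nonsquare2 y))].
Qed.
End BiquadraticIrreducibility.

(** * Reciprocity through determinants *)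

Section Reciprocity.
Variable k : fieldType.

(** The companion matrix, with its size written as a successor so that [horner_mx] applies. *)
Lemma exists_mx_char_poly (P : {poly k}) : P \is monic -> (1 < size P)%N ->
  exists n, exists2 C : 'M[k]_n.+1, (size P).-1 = n.+1 & char_poly C = P.
Proof.
move=> P_monic P_gt1; have := companionmxK P_monic.
have sizeE : (size P).-1 = (size P).-2.+1 by rewrite prednK // -subn1 subn_gt0.
move: (companionmx P); rewrite sizeE => C charC.
by exists (size P).-2, C.
Qed.

Lemma det_horner_mx_XsubC n (C : 'M[k]_n.+1) b :
  \det (horner_mx C ('X - b%:P)) = (-1) ^+ n.+1 * (char_poly C).[b].
Proof.
rewrite rmorphB /= horner_mx_X horner_mx_C -opprB -scaleN1r detZ; congr (_ * _).
rewrite /char_poly -[RHS]/(horner_eval b _) -det_map_mx; congr (\det _).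
apply/matrixP => i j; by rewrite !mxE /= /horner_eval hornerD hornerN hornerMn hornerX hornerC.
Qed.

(** Evaluate at a matrix [C] with characteristic polynomial [P]: by Cayley-Hamilton the divisible
    polynomial vanishes there. Taking determinants, which are norms from [k[X]/(P)], gives the
    identity with [z = det y(C)]. *)
Lemma dvd_square_sub_norm (P y : {poly k}) (e l : k) (rs : seq k) :
  P \is monic -> (1 < size P)%N ->
  P %| e *: y ^+ 2 - l *: \prod_(b <- rs) ('X - b%:P) ->
  exists z, e ^+ (size P).-1 * z ^+ 2 =
    (l * (-1) ^+ size rs) ^+ (size P).-1 * \prod_(b <- rs) P.[b].
Proof.
move=> P_monic P_gt1 P_dvd; have [n [C -> charC]] := exists_mx_char_poly P_monic P_gt1.
have : horner_mx C (e *: y ^+ 2 - l *: \prod_(b <- rs) ('X - b%:P)) = 0.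
  case/dvdpP: P_dvd => h ->.
  by have := Cayley_Hamilton C; rewrite rmorphM /= charC => ->; rewrite mulr0.
rewrite linearB !linearZ /= scalerN => /eqP; rewrite subr_eq0 => /eqP /(congr1 determinant).
rewrite !detZ rmorphXn rmorph_prod /= expr2 det_mulmx -expr2 => eq_det.
exists (\det (horner_mx C y)); rewrite eq_det exprMn -mulrA; congr (_ * _).
rewrite (big_morph determinant (@det_mulmx _ _) (det1 _ _)).
under eq_bigr do rewrite det_horner_mx_XsubC charC.
by rewrite big_split /= big_const_seq count_predT iter_mulr_1 exprAC.
Qed.

End Reciprocity.

(** Multiplying the norm identity by [e^n], with [n] the degree of [P], makes its left side a square
    and its scalar factor a power of [e * l * (-1)^(size rs)], of character 1. A square never has
    character -1. *)
Lemma quadratic_char_reciprocity (K : finFieldType) (P y : {poly K}) (e l : K) (rs : seq K) :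
  2%:R != 0 :> K -> P \is monic -> (1 < size P)%N ->
  quadratic_char (e * l * (-1) ^+ size rs) = 1 ->
  P %| e *: y ^+ 2 - l *: \prod_(b <- rs) ('X - b%:P) ->
  \prod_(b <- rs) quadratic_char P.[b] != -1.
Proof.
move=> two_neq0 P_monic P_gt1 eta_el /(dvd_square_sub_norm P_monic P_gt1)[z norm_eq].
set n := (size P).-1 in norm_eq.
have eta_eq : quadratic_char ((e ^+ n * z) ^+ 2) = \prod_(b <- rs) quadratic_char P.[b].
  have -> : (e ^+ n * z) ^+ 2 = (e * l * (-1) ^+ size rs) ^+ n * \prod_(b <- rs) P.[b].
    by rewrite -(mulrA e) [in RHS]exprMn -mulrA -norm_eq; ring.
  by rewrite quadratic_charM // quadratic_charX // eta_el expr1n mul1r quadratic_char_prod.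
rewrite -eta_eq.
have [->|z_neq0] := eqVneq (e ^+ n * z) 0.
  by rewrite expr0n quadratic_char0 eq_sym oppr_eq0.
by rewrite quadratic_char_square.
Qed.

(** * Descent of irreducible polynomials to a subfield *)

Lemma in_qpoly_eq0 (k : fieldType) (f h : {poly k}) : monic_irreducible_poly f ->
  (in_qpoly f h == 0) = (f %| h).
Proof.
move=> mi; have f_mk : mk_monic f = f by exact: mk_monicE mi.
by rewrite -val_eqE /= f_mk -Pdiv.IdomainMonic.modpE ?mi.2.
Qed.

Lemma exists_finite_splitting_field (F : finFieldType) (g : {poly F}) : g != 0 ->
  exists (K : finFieldType) (iota : {rmorphism F -> K}) (rs : seq K),
    map_poly iota g %= \prod_(z <- rs) ('X - z%:P).
Proof.
move=> /FinSplittingFieldFor[L [rs g_rs _]].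
by exists (finvect_type L), (in_alg L), rs.
Qed.

(** [P] divides some nonzero polynomial coming from [F]; by primality it divides either a chosen
    irreducible factor or the smaller cofactor, and induction on the size ends the search. *)
Lemma exists_irreducible_below (F K : finFieldType) (iota : {rmorphism F -> K})
  (P : {poly K}) : irreducible_poly P -> P \is monic ->
  exists f, monic_irreducible_poly f /\ P %| map_poly iota f.
Proof.
move=> P_irr P_monic; pose mi : monic_irreducible_poly P := (P_irr, P_monic).
have [f0 f0_neq0 P_dvd0] : exists2 f0 : {poly F}, f0 != 0 & P %| map_poly iota f0.
  pose Q := #|{poly %/ P with mi}|.
  (* In the residue field of [P], which has [Q] elements, every element is fixed by the [Q]-th
     power. *)
  exists ('X^Q - 'X).
    rewrite -size_poly_eq0 size_polyDl ?size_polyXn // size_polyN size_polyX ltnS.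
    exact: card_qfpoly_gt1.
  rewrite rmorphB /= map_polyXn map_polyX -(in_qpoly_eq0 _ mi) rmorphB rmorphXn /= subr_eq0.
  exact/eqP/(expf_card (in_qpoly P 'X : {poly %/ P with mi})).
have [n] := ubnP (size f0); elim: n f0 f0_neq0 P_dvd0 => // n IHn f f_neq0 P_dvd size_f.
have f_gt1 : (1 < size f)%N.
  rewrite -(size_map_poly iota) (leq_trans P_irr.1) // dvdp_leq //.
  by rewrite map_poly_eq0.
have l_neq0 : (lead_coef f)^-1 != 0 by rewrite invr_eq0 lead_coef_eq0.
pose g := (lead_coef f)^-1 *: f.
have g_monic : g \is monic by rewrite monicE lead_coefZ mulVf ?lead_coef_eq0.
have P_dvd_g : P %| map_poly iota g by rewrite map_polyZ dvdpZr ?fmorph_eq0.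
have size_g : size g = size f by rewrite size_scale.
have [|d [r r_prime r_dvd]] := exists_irreducible_factor g_monic; first by rewrite size_g.
move: r_prime; rewrite mem_primes_of_degree => /and3P[/irreducibleP r_irr r_monic _].
have [P_dvd_r|P_ndvd_r] := boolP (P %| map_poly iota r); first by exists r.
have /dvdpP[s g_eq] := r_dvd.
have g_neq0 := monic_neq0 g_monic.
have [s_neq0 r_neq0] : s != 0 /\ r != 0 by apply/andP; rewrite -negb_or -mulf_eq0 -g_eq.
apply: (IHn s) => //.
  move: P_dvd_g; rewrite g_eq rmorphM /= Gauss_dvdpl //.
  by rewrite irreducible_poly_coprime.
rewrite (leq_trans _ (_ : size f <= n)%N) // -size_g g_eq size_mul // -subn1.
by rewrite ltn_subRL addnC ltn_add2l r_irr.1.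
Qed.

(** * The closed points *)

Section SignPattern.
Variables (K : finFieldType) (p : nat) (c d : K) (rs1 rs2 : seq K).
Hypotheses (pchar_p : p \in [pchar K]) (two_neq0 : 2%:R != 0 :> K).
Hypotheses (c_neq0 : c != 0) (d_neq0 : d != 0).
(** At [a = u^p] the quantity [a^2 + g/e] is [u] times this polynomial for [Pi1] ([e = c],
    [g = d u]), and the next one for [Pi2] ([e = 4c], [g = 1 + 4 d u]). *)
Hypothesis rs1E : 'X^(p.*2.-1) + (d / c)%:P = \prod_(z <- rs1) ('X - z%:P).
Hypothesis rs2E :
  'X^(p.*2) + (d / c) *: 'X + ((4%:R * c)^-1)%:P = \prod_(z <- rs2) ('X - z%:P).

Let p_gt1 : (1 < p)%N. Proof. exact/prime_gt1/(pcharf_prime pchar_p). Qed.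

Let p_eq0 : p%:R = 0 :> K. Proof. exact: pcharf0. Qed.

Let dc_neq0 : d / c != 0. Proof. by rewrite mulf_neq0 ?invr_eq0. Qed.

Let four_neq0 : 4%:R != 0 :> K. Proof. by rewrite -[4%N]/(2 * 2)%N natrM mulf_neq0. Qed.

Lemma root_rs1 x : (x \in rs1) = (x ^+ p.*2.-1 + d / c == 0).
Proof. by rewrite -root_prod_XsubC -rs1E /root !hornerE. Qed.

Lemma root_rs2 x : (x \in rs2) = (x ^+ p.*2 + d / c * x + (4%:R * c)^-1 == 0).
Proof. by rewrite -root_prod_XsubC -rs2E /root !hornerE. Qed.

Lemma mulrn_double_pchar (x : {poly K}) : x *+ p.*2 = 0.
Proof. by rewrite -scaler_nat -addnn natrD p_eq0 addr0 scale0r. Qed.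

(** In characteristic [p], [X h' = - X^(2p-1)] for this polynomial [h], so [h + X h'] is the unit
    [d/c]. *)
Lemma uniq_rs1 : uniq rs1.
Proof.
rewrite -separable_prod_XsubC -rs1E unlock; apply/Bezout_coprimepP; exists (1, 'X) => /=.
have p2_gt0 : (0 < p.*2.-1)%N by have := p_gt1; lia.
have -> : 1 * ('X^(p.*2.-1) + (d / c)%:P) + 'X * ('X^(p.*2.-1) + (d / c)%:P)^`() = (d / c)%:P.
  rewrite derivD derivC addr0 derivXn mul1r mulrnAr -exprS prednK //.
  rewrite addrAC -mulrS prednK ?double_gt0 ?(ltnW p_gt1) //.
  by rewrite mulrn_double_pchar add0r.
by rewrite polyC_eqp1.
Qed.

(** The derivative is the nonzero constant [d/c]. *)
Lemma uniq_rs2 : uniq rs2.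
Proof.
rewrite -separable_prod_XsubC -rs2E unlock; apply/Bezout_coprimepP; exists (0, 1) => /=.
rewrite mul0r add0r mul1r !derivD derivC addr0 derivXn derivZ derivX.
by rewrite mulrn_double_pchar add0r alg_polyC polyC_eqp1.
Qed.

Lemma size_rs1 : size rs1 = p.*2.-1.
Proof.
apply: succn_inj; rewrite -(size_prod_XsubC rs1 id) -rs1E size_polyDl size_polyXn //.
rewrite size_polyC dc_neq0; have := p_gt1; lia.
Qed.

Lemma size_rs2 : size rs2 = p.*2.
Proof.
apply: succn_inj; rewrite -(size_prod_XsubC rs2 id) -rs2E -addrA size_polyDl size_polyXn //.
rewrite (leq_ltn_trans (size_polyD _ _)) // gtn_max (leq_ltn_trans (size_scale_leq _ _)).
  by rewrite (leq_ltn_trans (size_polyC_leq1 _)) //; have := p_gt1; lia.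
by rewrite size_polyX; have := p_gt1; lia.
Qed.

Let four_c_neq0 : (4%:R * c)^-1 != 0. Proof. by rewrite invr_eq0 mulf_neq0. Qed.

(** The second polynomial is [X] times the first plus a nonzero constant. *)
Lemma disjoint_roots x : x \in rs2 -> (x != 0) && (x \notin rs1).
Proof.
have -> : (x \in rs2) = (x * (x ^+ p.*2.-1 + d / c) + (4%:R * c)^-1 == 0).
  rewrite root_rs2 mulrDr -exprS prednK ?double_gt0 ?(ltnW p_gt1) //.
  by rewrite (mulrC x).
rewrite root_rs1 -negb_or -mulf_eq0 => /eqP eq0; apply: contra four_c_neq0 => /eqP eq1.
by move: eq0; rewrite eq1 add0r => ->.
Qed.

Lemma zero_notin_rs1 : 0 \notin rs1.
Proof.
rewrite root_rs1; have -> : p.*2.-1 = p.*2.-2.+1 by have := p_gt1; lia.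
by rewrite expr0n add0r.
Qed.

(** The root of [1 + 4 d u]. *)
Let b := - (4%:R * d)^-1.

Let b_neq0 : b != 0. Proof. by rewrite oppr_eq0 invr_eq0 mulf_neq0. Qed.

Lemma b_notin_rs2 : b \notin rs2.
Proof.
rewrite root_rs2 -addrA.
have -> : d / c * b + (4%:R * c)^-1 = 0.
  by rewrite /b; field; rewrite c_neq0 d_neq0 four_neq0.
by rewrite addr0 expf_neq0.
Qed.

Lemma prod_sign_count (A : {set K}) (rs : seq K) :
  \prod_(x <- rs) (-1) ^+ (x \in A) = (-1) ^+ count (mem A) rs :> rat.
Proof. by elim: rs => [|x rs IHrs]; rewrite ?big_nil // big_cons IHrs -exprD. Qed.

(* The signs at 0 and b are forced, one root of the second polynomial gets the
   sign -1, and a root h1 <> b of the first one compensates the sign at b. *)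
Lemma exists_sign_pattern : exists A : {set K}, [/\ 0 \in A, b \in A,
  \prod_(x <- rs1) (-1) ^+ (x \in A) = 1 :> rat &
  \prod_(x <- rs2) (-1) ^+ (x \in A) = -1 :> rat].
Proof.
have [h1 h1_rs1 h1_neqb] : exists2 h1, h1 \in rs1 & h1 != b.
  have rs1_gt1 : (1 < size rs1)%N by rewrite size_rs1; have := p_gt1; lia.
  case: rs1 uniq_rs1 rs1_gt1 => [|x [|y rs]] //=.
  move=> /andP[]; rewrite inE negb_or => /andP[neq_xy _] _ _.
  have [xb|] := eqVneq x b; last by exists x; rewrite // inE eqxx.
  by exists y; rewrite -?xb 1?eq_sym // !inE eqxx orbT.
have [h2 h2_rs2] : exists h2, h2 \in rs2.
  have : (0 < size rs2)%N by rewrite size_rs2 double_gt0 ltnW.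
  by case: rs2 => // x rs _; exists x; rewrite inE eqxx.
have /andP[h2_neq0 h2_rs1] := disjoint_roots h2_rs2.
exists [set x | [|| x == 0, x == b, x == h2 | (x == h1) && (b \in rs1)]].
rewrite !inE !eqxx orbT !prod_sign_count; split=> //.
  have [b_rs1|b_rs1] := boolP (b \in rs1).
    suff -> : count (mem [set x | [|| x == 0, x == b, x == h2 | (x == h1) && true]]) rs1 = 2%N.
      by rewrite sqrrN expr1n.
    rewrite -size_filter -[RHS]/(size [:: b; h1]); apply: perm_size; apply: uniq_perm.
    - by rewrite filter_uniq ?uniq_rs1.
    - by rewrite /= inE eq_sym h1_neqb.
    move=> x; rewrite mem_filter !inE andbT; apply/andP/orP.
      case=> /or4P[/eqP->|->|/eqP->|->]; rewrite ?(negPf zero_notin_rs1) ?(negPf h2_rs1) //.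
        by left.
      by right.
    by case=> /eqP->; rewrite ?b_rs1 ?h1_rs1 eqxx !orbT.
  suff -> : count (mem [set x | [|| x == 0, x == b, x == h2 | (x == h1) && false]]) rs1 = 0%N.
    by [].
  apply/eqP; rewrite -leqn0 leqNgt -has_count; apply/hasPn => x x_rs1 /=.
  rewrite !inE andbF orbF; apply/negP => /or3P[] /eqP x_eq; move: x_rs1; rewrite x_eq.
  - exact/negP/zero_notin_rs1.
  - exact/negP.
  - exact/negP.
suff -> : count (mem [set x | [|| x == 0, x == b, x == h2 | (x == h1) && (b \in rs1)]]) rs2 = 1%N.
  by rewrite expr1.
rewrite -size_filter -[RHS]/(size [:: h2]); apply: perm_size; apply: uniq_perm => //.
  by rewrite filter_uniq ?uniq_rs2.
move=> x; rewrite mem_filter !inE; apply/andP/eqP => [[]|->]; last by rewrite eqxx !orbT.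
case/or4P=> [/eqP->|/eqP->|/eqP//|/andP[/eqP-> _]] x_rs2.
- by have := disjoint_roots x_rs2; rewrite eqxx.
- by rewrite (negPf b_notin_rs2) in x_rs2.
- by have := disjoint_roots x_rs2; rewrite h1_rs1 andbF.
Qed.

End SignPattern.

Lemma split_monic_divisor (k : fieldType) (f g : {poly k}) (rs : seq k) :
  f \is monic -> f %| g -> g %= \prod_(z <- rs) ('X - z%:P) ->
  exists rs', f = \prod_(z <- rs') ('X - z%:P).
Proof.
move=> f_monic f_dvd g_eqp; move: f_dvd; rewrite (eqp_dvdr _ g_eqp).
case/dvdp_prod_XsubC=> m f_eqp; exists (mask m rs); apply/eqP.
by rewrite -eqp_monic // monic_prod_XsubC.
Qed.

Section ResidueField.
Variables (F K : finFieldType) (iota : {rmorphism F -> K}) (P : {poly K}) (f : {poly F}).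
Variable mi : monic_irreducible_poly f.
Hypotheses (P_monic : P \is monic) (P_gt1 : (1 < size P)%N).
Hypothesis P_dvd : P %| map_poly iota f.

Definition residue : {rmorphism {poly F} -> {poly %/ f with mi}} := in_qpoly f.

Lemma at_point_biquadratic (c a g : {poly F}) :
  at_point mi (c%:P * ('X^2 + a%:P) ^+ 2 + g%:P) =
  (residue c)%:P * ('X^2 + (residue a)%:P) ^+ 2 + (residue g)%:P.
Proof.
rewrite -[at_point mi _]/(map_poly residue _).
by rewrite rmorphD rmorphM rmorphXn rmorphD /= map_polyXn !map_polyC.
Qed.

Lemma residue_polyC_neq0 (e : F) : e != 0 -> residue e%:P != 0.
Proof.
move=> e_neq0; apply: contra_neq (oner_neq0 {poly %/ f with mi}) => eq0.
by rewrite -(rmorph1 residue) -polyC1 -(mulfV e_neq0) polyCM rmorphM eq0 mul0r.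
Qed.

Lemma at_point_biquadratic_irreducible (e : F) (a g : {poly F}) : e != 0 ->
  (forall y, residue e%:P * y ^+ 2 != residue (- g)) ->
  (forall y, residue e%:P * y ^+ 2 != residue (e%:P * a ^+ 2 + g)) ->
  irreducible_poly (at_point mi (e%:P%:P * ('X^2 + a%:P) ^+ 2 + g%:P)).
Proof.
move=> e_neq0 nonsquare1 nonsquare2; rewrite at_point_biquadratic.
apply: biquadratic_irreducible => [|y|y]; first exact: residue_polyC_neq0.
  by rewrite -rmorphN.
by have := nonsquare2 y; rewrite rmorphD rmorphM rmorphXn.
Qed.

(** A solution [y] lifts to a polynomial over [F] for which [f] divides [e y^2 - g]. Over [K], [P]
    then divides the image, and reciprocity forbids the product -1. *)
Lemma residue_nonsquare (e : F) (g : {poly F}) (l : K) (rs : seq K) :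
  2%:R != 0 :> K -> map_poly iota g = l *: \prod_(b <- rs) ('X - b%:P) ->
  quadratic_char (iota e * l * (-1) ^+ size rs) = 1 ->
  \prod_(b <- rs) quadratic_char P.[b] = -1 ->
  forall y, residue e%:P * y ^+ 2 != residue g.
Proof.
move=> two_neq0 g_split eta_el prod_eta y; apply/negP => eq_g.
have yE : y = residue (y : {poly F}).
  apply/val_inj/esym/in_qpoly_small.
  exact: size_mk_monic.
have f_dvd : f %| e *: (y : {poly F}) ^+ 2 - g.
  rewrite -(in_qpoly_eq0 _ mi) -[in_qpoly f _]/(residue _) rmorphB /= -mul_polyC.
  by rewrite rmorphM rmorphXn -yE subr_eq0.
have := quadratic_char_reciprocity (y := map_poly iota y) two_neq0 P_monic P_gt1 eta_el.
rewrite -g_split prod_eta eqxx => H; apply/(notF (H _)).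
rewrite -rmorphXn -map_polyZ -rmorphB /=; apply: dvdp_trans P_dvd _.
by rewrite dvdp_map.
Qed.

End ResidueField.

Theorem theorem5p8 (F : finFieldType) (p : nat) (c d : F) :
  p \in [pchar F] -> p != 2%N -> c != 0 -> d != 0 ->
  forall N : nat, exists (f : {poly F}) (mi : monic_irreducible_poly f),
    (N < size f)%N /\
    irreducible_poly (at_point mi (Pi1 p c d)) /\
    irreducible_poly (at_point mi (Pi2 p c d)).
Proof.
move=> pchar_p p_neq2 c_neq0 d_neq0 N.
have p_gt1 : (1 < p)%N by exact/prime_gt1/(pcharf_prime pchar_p).
have two_neq0 : 2%:R != 0 :> F.
  apply: contraNneq p_neq2 => two_eq0.
  have : 2%N \in [pchar F] by rewrite inE /= two_eq0 eqxx.
  by rewrite (pcharf_eq pchar_p) inE eq_sym.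
have four_neq0 : 4%:R != 0 :> F by rewrite -[4%N]/(2 * 2)%N natrM mulf_neq0.
(* [H1] and [H2] supply the roots carrying the signs; [H3] makes [c d] a square, so that the scalar
   [e * l * (-1)^(size rs)] has character 1 in the two linear conditions below. *)
pose H1 : {poly F} := 'X^(p.*2.-1) + (d / c)%:P.
pose H2 : {poly F} := 'X^(p.*2) + (d / c) *: 'X + ((4%:R * c)^-1)%:P.
pose H3 : {poly F} := 'X^2 - (c * d)%:P.
have H1_monic : H1 \is monic.
  rewrite monicE lead_coefDl ?lead_coefXn // size_polyXn ltnS.
  by rewrite (leq_trans (size_polyC_leq1 _)) //; lia.
have H2_monic : H2 \is monic.
  rewrite /H2 -addrA monicE lead_coefDl ?lead_coefXn // size_polyXn ltnS.
  rewrite (leq_trans (size_polyD _ _)) // geq_max (leq_trans (size_scale_leq _ _)).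
    by rewrite (leq_trans (size_polyC_leq1 _)) //; lia.
  by rewrite size_polyX; lia.
have H3_monic : H3 \is monic by apply: monicXnsubC.
have [|K [iota [rs G_split]]] := @exists_finite_splitting_field F (H1 * H2 * H3).
  by rewrite monic_neq0 // !rpredM.
pose c' := iota c; pose d' := iota d.
have H1K : map_poly iota H1 = 'X^(p.*2.-1) + (d' / c')%:P.
  by rewrite rmorphD /= map_polyXn map_polyC /= fmorph_div.
have H2K : map_poly iota H2 = 'X^(p.*2) + (d' / c') *: 'X + ((4%:R * c')^-1)%:P.
  rewrite !rmorphD /= map_polyXn map_polyC map_polyZ /= map_polyX fmorph_div fmorphV.
  by rewrite rmorphM /= rmorph_nat.
have split_factor H : H \is monic -> H %| H1 * H2 * H3 ->
    exists rs', map_poly iota H = \prod_(z <- rs') ('X - z%:P).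
  move=> H_monic H_dvd; apply: split_monic_divisor _ _ G_split.
    by rewrite map_monic.
  by rewrite dvdp_map.
have [rs1] := split_factor H1 H1_monic (dvdp_mulr _ (dvdp_mulr _ (dvdpp _))).
rewrite H1K => rs1E.
have [rs2] := split_factor H2 H2_monic (dvdp_mulr _ (dvdp_mull _ (dvdpp _))).
rewrite H2K => rs2E.
have [rs3 rs3E] := split_factor H3 H3_monic (dvdp_mull _ (dvdpp _)).
have c'_neq0 : c' != 0 by rewrite fmorph_eq0.
have d'_neq0 : d' != 0 by rewrite fmorph_eq0.
have two_neq0' : 2%:R != 0 :> K by rewrite -(rmorph_nat iota) fmorph_eq0.
have four_neq0' : 4%:R != 0 :> K by rewrite -(rmorph_nat iota) fmorph_eq0.
have pchar_p' : p \in [pchar K] by rewrite (fmorph_pchar iota).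
have eta_sqr (x : K) y : x = y ^+ 2 -> x != 0 -> quadratic_char x = 1.
  by move=> ->; rewrite expf_eq0 => y_neq0; rewrite quadratic_char_square.
have [z z_sqr] : exists z, c' * d' = z ^+ 2.
  have : size rs3 = 2%N.
    by apply: succn_inj; rewrite -(size_prod_XsubC rs3 id) -rs3E size_map_poly size_XnsubC.
  case: rs3 rs3E => // z rs3 rs3E _; exists z; apply/eqP; rewrite eq_sym -subr_eq0.
  have : root (map_poly iota H3) z by rewrite rs3E root_prod_XsubC inE eqxx.
  by rewrite rmorphB /= map_polyXn map_polyC /= rmorphM /root !hornerE.
have [A [A_0 A_b A_rs1 A_rs2]] :=
  exists_sign_pattern pchar_p' two_neq0' c'_neq0 d'_neq0 rs1E rs2E.
have A_neq0 : A != set0 by apply/set0Pn; exists 0.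
have [P [P_irr P_monic size_P eta_P]] :=
  irreducible_with_prescribed_signs two_neq0' N A_neq0.
have P_gt1 := P_irr.1.
have [f [mi P_dvd]] := exists_irreducible_below iota P_irr P_monic.
exists f, mi; split.
  rewrite (leq_trans size_P) // -(size_map_poly iota) dvdp_leq //.
  by rewrite map_poly_eq0 monic_neq0 ?mi.2.
have eta_prod r : \prod_(x <- r) quadratic_char P.[x] = \prod_(x <- r) (-1) ^+ (x \in A).
  by apply: eq_bigr.
have nonsquare e g l r := @residue_nonsquare F K iota P f mi P_monic P_gt1 P_dvd
  e g l r two_neq0'.
have X2p (k : fieldType) : 'X * 'X^(p.*2.-1) = 'X^p ^+ 2 :> {poly k}.
  by rewrite -exprS prednK ?double_gt0 ?(ltnW p_gt1) // -muln2 exprM.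
have -> : Pi2 p c d = (4%:R * c)%:P%:P * ('X^2 + ('X^p)%:P) ^+ 2 + (1 + (4%:R * d) *: 'X)%:P.
  rewrite /Pi2 /Pi1 -!mul_polyC; rewrite !polyCD !polyCM; ring.
have c'd'_neq0 : c' * d' != 0 by rewrite mulf_neq0.
split; apply: at_point_biquadratic_irreducible; rewrite ?mulf_neq0 //.
(* Here [-g = - d u] has the single root 0. *)
- move=> y; apply: (nonsquare c _ (- d') [:: 0]).
  + by rewrite rmorphN /= map_polyZ /= map_polyX big_seq1 subr0 scaleNr.
  + by rewrite -(eta_sqr _ z z_sqr) //; congr quadratic_char; rewrite /=; ring.
  + by rewrite eta_prod big_seq1 A_0.
(* Here [e a^2 + g = c u (u^(2p-1) + d/c)], with an even number of roots. *)
- move=> y; apply: (nonsquare c _ c' (0 :: rs1)).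
  + rewrite big_cons -rs1E subr0 mulrDr X2p -!mul_polyC !rmorphD !rmorphM /= !rmorphXn /=.
    rewrite !map_polyC !map_polyX /= mulrDr; congr (_ + _).
    by rewrite -[iota d](divfK c'_neq0) -/d' polyCM; ring.
  + rewrite /= (size_rs1 pchar_p' two_neq0' c'_neq0 d'_neq0 rs1E).
    rewrite prednK ?double_gt0 ?(ltnW p_gt1) //.
    by rewrite -signr_odd odd_double mulr1; apply: (eta_sqr _ c'); rewrite ?expr2 ?mulf_neq0.
  + by rewrite eta_prod big_cons A_0 A_rs1 mulr1.
(* Here [-g = -(1 + 4 d u)], and the scalar is [16 c d], a square in [K]. *)
- move=> y; apply: (nonsquare (4%:R * c) _ (- (4%:R * d')) [:: - (4%:R * d')^-1]).
  + rewrite big_seq1 polyCN opprK rmorphN rmorphD rmorph1 /= map_polyZ /= map_polyX.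
    rewrite rmorphM /= rmorph_nat scaleNr scalerDr -mul_polyC -[_ *: _%:P]mul_polyC -polyCM.
    by rewrite mulfV ?mulf_neq0 // addrC mul_polyC.
  + apply: (eta_sqr _ (4%:R * z)); rewrite rmorphM /= rmorph_nat -/c' expr1.
      by transitivity (4%:R ^+ 2 * (c' * d')); [ring | rewrite z_sqr; ring].
    by rewrite !mulf_neq0 ?oppr_eq0 ?oner_neq0 ?mulf_neq0.
  + by rewrite eta_prod big_seq1 A_b.
(* Here [e a^2 + g = 4c (u^(2p) + (d/c) u + 1/(4c))]. *)
- move=> y; apply: (nonsquare (4%:R * c) _ (4%:R * c') rs2).
  + rewrite -rs2E -muln2 exprM -!mul_polyC !rmorphD !rmorphM /= !rmorphXn /= !rmorph1.
    rewrite !map_polyC !map_polyX /= !rmorph_nat -/c' -/d'.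
    have cw : c'%:P * (c'^-1)%:P = 1 by rewrite -polyCM mulfV.
    have cv : (4%:R%:P * c'%:P) * ((4%:R * c')^-1)%:P = 1.
      by rewrite -!polyCM mulfV ?mulf_neq0.
    transitivity (4%:R%:P * c'%:P * 'X^p ^+ 2 + (4%:R%:P * c'%:P * ((4%:R * c')^-1)%:P
        + 4%:R%:P * d'%:P * 'X * (c'%:P * (c'^-1)%:P))); last by ring.
    by rewrite cw cv; ring.
  + rewrite (size_rs2 pchar_p' two_neq0' c'_neq0 d'_neq0 rs2E).
    rewrite -signr_odd odd_double mulr1 rmorphM /= rmorph_nat.
    by apply: (eta_sqr _ (4%:R * c')); rewrite ?expr2 ?mulf_neq0.
  + by rewrite eta_prod A_rs2.
Qed.
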